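(* Let $(X,f)$ be a dynamical system (so $X$ is a compact uniform space and $f:X\to X$ is a continuous onto map) such that $f$ is chain recurrent, i.e. $CR(f)=X$. Then the following are equivalent: (1) $f$ has topological shadowing; (2) $f$ has topological $(\mathscr{D},\mathscr{F}_t)$-shadowing; (3) $f$ has topological $(\mathscr{F}_t,\mathscr{F}_t)$-shadowing; (4) $f$ has topological $(\mathbb{N},\mathscr{F}_t)$-shadowing.
   Context: Here $\mathbb{N}=\{1,2,\dots\}$. A dynamical system is a pair $(X,f)$ where $X$ is a compact uniform space with uniformity $\mathscr{U}$ (whose members are called entourages) and $f:X\to X$ is a continuous onto map. A family of subsets of $\mathbb{N}$ is a set $\mathscr{F}\subset\mathscr{P}(\mathbb{N})$ that is upward hereditary: $B\in\mathscr{F}$ and $B\subset C\subset\mathbb{N}$ imply $C\in\mathscr{F}$. $\mathscr{F}_t$ is the family of thick sets, i.e. subsets of $\mathbb{N}$ containing arbitrarily long blocks of consecutive integers. $\mathscr{D}$ is the family of sets $A\subset\mathbb{N}$ of density $1$, i.e. $\lim_{n\to\infty}|A\cap\{0,1,\dots,n-1\}|/n=1$. In ''$(\mathbb{N},\mathscr{F}_t)$-shadowing'', $\mathbb{N}$ stands for the family $\{\mathbb{N}\}$. For an entourage $D$, a sequence $\{x_i\}_{i=1}^\infty$ in $X$ is a $D$-pseudo orbit if $(f(x_i),x_{i+1})\in D$ for all $i\in\mathbb{N}$; it is a $D$-pseudo orbit on $A\subset\mathbb{N}$ if $A\subset\{i:(f(x_i),x_{i+1})\in D\}$. For an entourage $E$,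 a sequence $\{x_i\}_{i=1}^\infty$ is $E$-traced ($E$-shadowed) by $y\in X$ if $(f^i(y),x_i)\in E$ for all $i\in\mathbb{N}$, and $E$-shadowed by $y$ on $B\subset\mathbb{N}$ if $B\subset\{i:(f^i(y),x_i)\in E\}$. $f$ has topological shadowing if for every entourage $E$ there is an entourage $D$ such that every $D$-pseudo orbit is $E$-traced by some point of $X$. For families $\mathscr{F},\mathscr{G}$, $f$ has topological $(\mathscr{F},\mathscr{G})$-shadowing if for every entourage $E$ there is an entourage $D$ such that whenever $\{x_i\}_{i=1}^\infty$ is a $D$-pseudo orbit on some $A\in\mathscr{F}$, there is a point $x\in X$ such that $\{x_i\}_{i=1}^\infty$ is $E$-shadowed by $x$ on some $B\in\mathscr{G}$. For an entourage $D$, a $D$-chain from $x$ to $y$ is a finite sequence $x=x_0,x_1,\dots,x_n=y$ with $n\ge 1$ and $(f(x_i),x_{i+1})\in D$ for $0\le i\le n-1$. A point $x$ is chain recurrent if for every entourage $D$ there is a $D$-chain from $x$ to $x$; $CR(f)$ is the set of chain recurrent points. *)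

(* Defs.v *)
From HB Require Import structures.
From mathcomp Require Import all_boot all_order all_algebra.
From mathcomp Require Import all_classical all_reals all_analysis.
Set Implicit Arguments.
Unset Strict Implicit.
Unset Printing Implicit Defensive.
Import Order.TTheory GRing.Theory Num.Theory.
Import numFieldNormedType.Exports.
Local Open Scope classical_set_scope.
Local Open Scope ring_scope.

(* Indices range over {1, 2, ...}.  A sequence is a function [nat -> X] whose
   value at 0 is never inspected, and a set of indices is a subset of [posn]. *)
Definition posn : set nat := [set i | (0 < i)%N].

Definition is_family (F : set (set nat)) : Prop :=
  (forall A, F A -> A `<=` posn) /\
  (forall B C, F B -> B `<=` C -> C `<=` posn -> F C).

Definition thick : set (set nat) :=
  [set A | A `<=` posn /\
    forall k : nat, exists2 m : nat, (0 < m)%N &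
      forall i : nat, (m <= i < m + k)%N -> A i].

Definition density_one (R : realType) : set (set nat) :=
  [set A | A `<=` posn /\
    (fun n : nat => #|[pred i : 'I_n | (i : nat) \in A]|%:R / n%:R : R)
      @ \oo --> (1 : R)].

Lemma is_family_thick : is_family thick.
Proof.
split=> [A [] //|B C [_ Bt] BC Cp]; split=> // k.
by have [m m0 Bm] := Bt k; exists m => // i /Bm /BC.
Qed.

Lemma is_family_density_one (R : realType) : is_family (density_one R).
Proof.
split=> [A [] //|B C [_ Bd] BC Cp]; split=> //.
apply: (squeeze_cvgr _ Bd (cvg_cst (1 : R))).
near=> n; apply/andP; split.
  rewrite ler_wpM2r ?invr_ge0 ?ler0n // ler_nat subset_leq_card //.
  by apply/fintype.subsetP => i; rewrite !unfold_in => /set_mem /BC /mem_set.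
rewrite ler_pdivrMr ?mul1r ?ltr0n; last by near: n; exact: nbhs_infty_gt.
by rewrite ler_nat -[leqRHS]card_ord max_card.
Unshelve. all: by end_near. Qed.

Lemma is_family_posn : is_family [set posn].
Proof.
by split=> [A -> //|B C -> pC Cp]; apply/seteqP.
Qed.

Definition dynamical_system (X : uniformType) (f : X -> X) : Prop :=
  [/\ compact [set: X], continuous f & range f = [set: X]].

Section shadowing.
Variables (X : uniformType) (f : X -> X).
Implicit Types (D E : set (X * X)) (x : nat -> X) (A B : set nat).

Definition pseudo_orbit_on D A x : Prop :=
  A `<=` [set i | D (f (x i), x i.+1)].

Definition pseudo_orbit D x : Prop :=
  forall i : nat, (0 < i)%N -> D (f (x i), x i.+1).

Definition shadowed_on E B x (y : X) : Prop :=
  B `<=` [set i | E (iter i f y, x i)].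

Definition traced E x (y : X) : Prop :=
  forall i : nat, (0 < i)%N -> E (iter i f y, x i).

Definition topological_shadowing : Prop :=
  forall E, entourage E -> exists2 D, entourage D &
    forall x, pseudo_orbit D x -> exists y, traced E x y.

Definition topological_family_shadowing (F G : set (set nat)) : Prop :=
  forall E, entourage E -> exists2 D, entourage D &
    forall x, (exists2 A, F A & pseudo_orbit_on D A x) ->
      exists y, exists2 B, G B & shadowed_on E B x y.

Definition chain D (a b : X) : Prop :=
  exists n : nat, exists c : nat -> X,
    [/\ (0 < n)%N, c 0%N = a, c n = b &
        forall i : nat, (i < n)%N -> D (f (c i), c i.+1)].

Definition chain_recurrent_set : set X :=
  [set a | forall D, entourage D -> chain D a a].

End shadowing.

(* Main.v *)
Require Import Defs.
From HB Require Import structures.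
From mathcomp Require Import all_boot all_order all_algebra.
From mathcomp Require Import all_classical all_reals all_analysis.
From mathcomp Require Import zify.
Import Order.TTheory GRing.Theory Num.Theory.
Import numFieldNormedType.Exports.
Local Open Scope classical_set_scope.
Local Open Scope ring_scope.

(* Chain recurrence makes chains reversible, and, by pigeonhole along the orbit
   of a, any chain from a to b extends to a chain that comes back to the orbit
   of a in phase.

   From shadowing to (thick, thick)-shadowing: pull the start x (m k) of the
   k-th good block back to a point u k with f^(m k) (u k) = x (m k), and let z be
   a cluster point of u. Being in phase with the orbit of z at some time, jump to
   the orbit of a u k close enough to z, run through the k-th block of x, and
   come back in phase to the orbit of z. Repeating this gives a pseudo orbit that
   agrees with x on a thick set.

   From (N, thick)-shadowing to shadowing: by compactness it is enough to trace
   finite pseudo orbits; closing one up gives a periodic pseudo orbit, and a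
   thick set contains a full period. *)

(** * Uniform continuity and cluster points on a compact uniform space *)

Section compact_uniform.
Set Implicit Arguments.
Unset Strict Implicit.
Context {X : uniformType}.
Hypothesis cptX : compact [set: X].

Lemma compact_unif_continuous (f : X -> X) : continuous f ->
  forall E, entourage E ->
  exists2 D, entourage D & forall a b, D (a, b) -> E (f a, f b).
Proof.
move=> cf E entE.
have entS : entourage (split_ent E) by exact: entourage_split_ent.
(* Quantifying over [a] under the equation [a = p.1] gives the shape required by the near-covering
   form of compactness. *)
suff : entourage (fun p : X * X =>
    [set: X] `<=` fun a => a = p.1 -> E (f a, f p.2)).
  by move=> entD; eexists; [exact: entD | move=> a b Dab; exact: Dab].
apply: (iffLR (compact_near_coveringP _) cptX _ _
  (fun p a => a = p.1 -> E (f a, f p.2))) => a _.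
have /nbhsP[U entU fU] :
    nbhs a (f @^-1` xsection (split_ent E `&` (split_ent E)^-1%relation) (f a)).
  by apply: cf; apply: nbhs_entourage; exact: entourage_invI.
have [V entV VU] := entourage_split_ex entU.
exists (xsection V a, V) => /=; first by split; first exact: nbhs_entourage.
move=> [x [a' b]] /= [/xsectionP Vaa' Vab] xE; rewrite xE in Vaa' *.
have fUP c : U (a, c) -> (split_ent E `&` (split_ent E)^-1%relation) (f a, f c).
  by move=> Uac; apply/xsectionP/fU/xsectionP.
have [_ faa'] : (split_ent E `&` (split_ent E)^-1%relation) (f a, f a').
  by apply/fUP/VU; exists a => //; exact: entourage_refl.
have [fab _] : (split_ent E `&` (split_ent E)^-1%relation) (f a, f b).
  by apply/fUP/VU; exists a'.
exact: (entourage_split (f a) entE).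
Qed.

Lemma compact_seq_cluster (u : nat -> X) : exists p : X,
  forall E, entourage E -> forall N, exists2 n, (N <= n)%N & E (p, u n).
Proof.
have [] := @cptX (u @ \oo) _; first exact: filterT.
move=> p [_ clp]; exists p => E entE N.
have uN : (u @ \oo) (u @` [set n | (N <= n)%N]).
  by exists N => // n /= Nn; exists n.
have [_ [[n Nn <-] /xsectionP Epn]] := clp _ _ uN (nbhs_entourage p entE).
by exists n.
Qed.

(** Two terms near one cluster point are near each other; the second is sought after the first. *)
Lemma compact_seq_recurrence (u : nat -> X) E : entourage E ->
  exists j1 j2, (0 < j1 < j2)%N /\ E (u j1, u j2).
Proof.
move=> entE; have [p clp] := compact_seq_cluster u.
have [D entD DE] := entourage_split_ex entE.
have [j1 j1p Dj1] := clp _ (entourage_inv entD) 1%N.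
have [j2 j12 Dj2] := clp _ entD j1.+1.
by exists j1, j2; split; [apply/andP | apply: DE; exists p].
Qed.

End compact_uniform.

Lemma continuous_iter (T : topologicalType) (f : T -> T) (n : nat) :
  continuous f -> continuous (iter n f).
Proof.
move=> cf; elim: n => [|n IHn] t /=; first by move=> A.
exact: (continuous_comp (IHn t) (cf _)).
Qed.

(** * Finite chains: concatenation, reversal, return in phase *)

Section finite_chains.
Set Implicit Arguments.
Unset Strict Implicit.
Context {X : uniformType} (f : X -> X).
Implicit Types (D E : set (X * X)) (c d x : nat -> X) (a b : X).

Definition finite_orbit D n c := forall i, (i < n)%N -> D (f (c i), c i.+1).

Definition splice n c d : nat -> X :=
  fun i => if (i <= n)%N then c i else d (i - n)%N.

Lemma splicel n c d i : (i <= n)%N -> splice n c d i = c i.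
Proof. by rewrite /splice => ->. Qed.

Lemma splicer n c d i : c n = d 0%N -> splice n c d (n + i) = d i.
Proof.
rewrite /splice; case: i => [|i]; first by rewrite addn0 leqnn.
by rewrite ifF ?addKn//; lia.
Qed.

Lemma finite_orbit_splice D n m c d : finite_orbit D n c ->
  finite_orbit D m d -> c n = d 0%N -> finite_orbit D (n + m) (splice n c d).
Proof.
move=> Dc Dd cd i im; have [ltin|leni] := ltnP i n.
  by rewrite !splicel; [exact: Dc | | exact: ltnW].
have -> : i = (n + (i - n))%N by lia.
by rewrite -addnS !splicer//; apply: Dd; lia.
Qed.

(** Unlike in [chain], the length is explicit, so that phases can be compared, and it may be 0. *)
Definition chainn D n a b :=
  exists c, [/\ c 0%N = a, c n = b & finite_orbit D n c].

Lemma chainn_cat D n m a b e :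
  chainn D n a b -> chainn D m b e -> chainn D (n + m) a e.
Proof.
move=> [c [c0 cn Dc]] [d [d0 dm Dd]].
have cd : c n = d 0%N by rewrite cn d0.
exists (splice n c d); split; last exact: finite_orbit_splice.
  by rewrite splicel.
by rewrite splicer.
Qed.

Lemma chainn0 D a : chainn D 0 a a.
Proof. by exists (fun=> a); split. Qed.

Lemma chainn1 D a b : D (f a, b) -> chainn D 1 a b.
Proof. by exists (fun i => if i is 0%N then a else b); split=> // -[]. Qed.

Lemma chainn_mul D n k a : chainn D n a a -> chainn D (k * n) a a.
Proof.
by move=> Dn; elim: k => [|k]; [exact: chainn0 | exact: chainn_cat].
Qed.

Lemma chainn_orbit D n a : entourage D -> chainn D n a (iter n f a).
Proof.
by move=> entD; exists (fun i => iter i f a); split=> // i _; exact: entourage_refl.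
Qed.

Lemma chainnW D E n a b : D `<=` E -> chainn D n a b -> chainn E n a b.
Proof. by move=> DE [c [c0 cn Dc]]; exists c; split=> // i /Dc /DE. Qed.

Hypotheses (cptX : compact [set: X]) (cf : continuous f).
Hypothesis hCR : chain_recurrent_set f = [set: X].

(** A loop run twice has length at least 2; reversing a step uses the point [c 2] of the loop. *)
Lemma chain_recurrent_chainn D a : entourage D ->
  exists n, chainn D n.+2 a a.
Proof.
move=> entD; have : chain_recurrent_set f a by rewrite hCR.
move=> /(_ D entD) [[|n] [c [// _ c0 cn Dc]]].
have aa : chainn D n.+1 a a by exists c.
by exists (n + n)%N; have := chainn_cat aa aa; rewrite addSn addnS.
Qed.

(* If b is close to f a and a, c 1, c 2, ..., a is a fine chain, then
   b, c 2, ..., a is a chain, because f b is close to f (c 1). *)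
Lemma chainn_reverse D : entourage D -> exists D', [/\ entourage D', D' `<=` D &
  forall n a b, (0 < n)%N -> chainn D' n a b ->
    exists2 r, (0 < r)%N & chainn D r b a].
Proof.
move=> entD; have [S entS SD] := entourage_split_ex entD.
have [U entU fU] := compact_unif_continuous cptX cf entS.
have [V entV VU] := entourage_split_ex entU.
pose D' := V^-1%relation `&` D.
have entD' : entourage D' by apply: filterI => //; exact: entourage_inv.
have edge a b : D' (f a, b) -> exists2 r, (0 < r)%N & chainn D r b a.
  move=> [Vab _].
  have [n [c [c0 cn Wc]]] :=
    @chain_recurrent_chainn (V `&` (S `&` D)) a (filterI entV (filterI entS entD)).
  exists n.+1 => //; exists (fun i => if i is 0%N then b else c i.+1); split=> //.
  move=> [_|i ilt]; last by have [_ []] := Wc i.+2 ilt.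
  have [] := Wc 0%N isT; rewrite c0 => V1 _.
  have [_ [S2 _]] := Wc 1%N isT.
  by apply: SD; exists (f (c 1%N)) => //; apply: fU; apply: VU; exists (f a).
exists D'; split=> //; first by move=> t [].
elim=> [//|n IHn] a b _ [c [c0 cn Dc]].
have [r r0 Dr] : exists2 r, (0 < r)%N & chainn D r b (c n).
  by apply: edge; rewrite -cn; exact: Dc.
case: n => [|n] in IHn c0 cn Dc Dr *; first by exists r => //; rewrite -c0.
have [s s0 Ds] : exists2 s, (0 < s)%N & chainn D s (c n.+1) a.
  by apply: IHn => //; exists c; split=> // i ilt; apply: Dc; exact: ltnW.
by exists (r + s)%N; [rewrite addn_gt0 r0 | exact: chainn_cat Ds].
Qed.

(* A chain from a to b of length n closes up to a loop at a of some length L.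
   Two points [iter (j1 * L) f a] and [iter (j2 * L) f a] with j1 < j2 are close
   to each other, so delaying by j2 - j1 loops at a and then following the
   orbit of a ends on that orbit without phase shift. *)
Lemma chainn_return D : entourage D -> exists D', [/\ entourage D', D' `<=` D &
  forall n a b, (0 < n)%N -> chainn D' n a b ->
    exists2 r, (0 < r)%N & chainn D r b (iter (n + r) f a)].
Proof.
move=> entD; have [D' [entD' D'D rev]] := chainn_reverse entD.
exists D'; split=> // n a b n0 Dab; have [s s0 Dba] := rev n a b n0 Dab.
have Dab' := chainnW D'D Dab; pose L := (n + s)%N.
have DL : chainn D L a a by exact: chainn_cat Dba.
have [j1 [j2 [/andP[j10 j12] Dj]]] :=
  compact_seq_recurrence cptX (fun j => iter (j * L) f a) entD.
(* Return to [a], wait, then follow the orbit, with a last step that jumps to time [j2 * L]. The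
   wait is one loop short of [j2 - j1] because the return to [a] already completes one. *)
exists (s + ((j2 - j1.+1) * L + j1 * L))%N; first by rewrite addn_gt0 s0.
have -> : (n + (s + ((j2 - j1.+1) * L + j1 * L)) = j2 * L)%N.
  have -> : j2 = (j1.+1 + (j2 - j1.+1))%N by lia.
  by rewrite [in RHS]mulnDl mulSn /L; lia.
apply: chainn_cat Dba (chainn_cat (chainn_mul _ DL) _).
have [k kE] : exists k, (j1 * L = k.+1)%N.
  by exists (j1 * L).-1; rewrite prednK// muln_gt0 j10 addn_gt0 n0.
rewrite kE -addn1; apply: chainn_cat (chainn_orbit k a entD) _.
by apply: chainn1; move: Dj; rewrite /= kE.
Qed.

End finite_chains.

(** * Gluing segments; shadowing versus shadowing on thick sets *)

Section shadowing.
Context {X : uniformType} (f : X -> X).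
Set Implicit Arguments.
Unset Strict Implicit.

(* Segments that start and end on the orbit of z, in phase with it, can be
   concatenated in any order. *)
Lemma glue_segments (D : set (X * X)) (z : X) (Q : nat -> (nat -> X) -> Prop) :
  (forall n w, exists w' c, [/\ (w < w')%N, finite_orbit f D w' c,
     c w = iter w f z, c w' = iter w' f z &
     forall g, (forall i, (w <= i < w')%N -> g i = c i) -> Q n g]) ->
  exists g, (forall i, D (f (g i), g i.+1)) /\ forall n, Q n g.
Proof.
move=> seg; have /choice[W /choice[C CP]] : forall nw : nat * nat,
    exists w' c, [/\ (nw.2 < w')%N, finite_orbit f D w' c,
     c nw.2 = iter nw.2 f z, c w' = iter w' f z &
     forall g, (forall i, (nw.2 <= i < w')%N -> g i = c i) -> Q nw.1 g].
  by move=> [n w]; exact: seg.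
have [w [w0 wE]] : exists w, w 0%N = 0%N /\ forall n, w n.+1 = W (n, w n).
  by exists (fix w n := if n is n'.+1 then W (n', w n') else 0%N).
have wS n : (w n < w n.+1)%N by rewrite wE; have [] := CP (n, w n).
have w_le m n : (m <= n)%N -> (w m <= w n)%N.
  by elim: n => [|n IHn]; rewrite leq_eqVlt => /predU1P[->//|//]; rewrite ltnS
    => /IHn wmn; exact: leq_trans wmn (ltnW (wS n)).
have /choice[idx idxP] i : exists n, (w n <= i < w n.+1)%N.
  elim: i => [|i [n /andP[wi iw]]]; first by exists 0%N; have := wS 0%N; rewrite w0.
  have [lt_iw|le_wi] := ltnP i.+1 (w n.+1).
    by exists n; rewrite lt_iw (leqW wi).
  by exists n.+1; rewrite le_wi (leq_ltn_trans iw).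
have idxE n i : (w n <= i < w n.+1)%N -> idx i = n.
  move=> /andP[wi iw]; have /andP[wi' iw'] := idxP i.
  by have [lti|lti|//] := ltngtP (idx i) n; have := w_le _ _ lti; lia.
pose g i := C (idx i, w (idx i)) i.
have gE n i : (w n <= i < w n.+1)%N -> g i = C (n, w n) i.
  by rewrite /g => /idxE ->.
(* At a cut time both neighbouring segments sit on the orbit of [z], so the right end can be
   included; this yields the step of [g] into a cut. *)
have gE' n i : (w n <= i <= w n.+1)%N -> g i = C (n, w n) i.
  move=> /andP[wi]; rewrite leq_eqVlt => /predU1P[->|iw]; last first.
    by apply: gE; rewrite wi iw.
  rewrite (gE n.+1) ?leqnn ?wS//.
  by have [_ _ _ + _] := CP (n, w n); have [_ _ -> _ _] := CP (n.+1, w n.+1); rewrite -wE.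
exists g; split=> [i|n].
  have /andP[wi iw] := idxP i.
  rewrite (gE (idx i)) ?wi// (gE' (idx i)) ?(leqW wi)//.
  by have [_ DC _ _ _] := CP (idx i, w (idx i)); apply: DC; rewrite -wE.
by have [_ _ _ _] := CP (n, w n); apply => i /=; rewrite -wE; exact: gE.
Qed.

(** The second half of a block of length [k + k] starts after [k]. *)
Lemma thick_late (A : set nat) : thick A -> forall k,
  exists2 m, (k <= m)%N & forall i, (m <= i < m + k)%N -> A i.
Proof.
move=> [_ tA] k; have [m _ Am] := tA (k + k)%N.
by exists (m + k)%N => [|i im]; [lia | apply: Am; lia].
Qed.

Lemma thick_topological_shadowing : dynamical_system f ->
  topological_family_shadowing f [set posn] thick ->
  chain_recurrent_set f = [set: X] -> topological_shadowing f.
Proof.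
move=> [cptX cf _] sh hCR E entE.
have [E0 entE0 E0E] := entourage_split_ex entE.
have [D entD shD] := sh _ entE0.
have [D' [entD' D'D rev]] := chainn_reverse cptX cf hCR entD.
exists D' => // x Dx.
have fin n : exists y, forall i, (0 < i <= n)%N -> E0 (iter i f y, x i).
  have [|r r0 [d [d0 dr Dd]]] := rev n.+1 (x 1%N) (x n.+2) isT.
    by exists (fun i => x i.+1); split=> // i _; exact: Dx.
  have Dx' : finite_orbit f D n.+1 (fun i => x i.+1) by move=> i _; apply/D'D/Dx.
  pose c := splice n.+1 (fun i => x i.+1) d; pose L := (n.+1 + r)%N.
  have Dc : finite_orbit f D L c by apply: finite_orbit_splice.
  have cL : c L = c 0%N by rewrite /c splicer.
  have [|y [B [_ tB] By]] := shD (fun i => c (i %% L)%N).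
    exists posn => // i _ /=; have iL : (i %% L < L)%N by rewrite ltn_mod addn_gt0.
    have := Dc _ iL; rewrite modnS; case: ifPn => // Li.
    (* Here [L] divides [i.+1]: the period wraps around and [cL] closes it. *)
    suff -> : (i %% L).+1 = L by rewrite cL.
    apply/eqP; rewrite eqn_leq iL dvdn_leq//.
    by move: Li; rewrite {1}(divn_eq i L) -addnS dvdn_addr// dvdn_mull.
  (* A block of two periods contains the full period starting at the multiple [j * L]. *)
  have [m m0 Bm] := tB (L + L)%N.
  pose j := (m %/ L).+1.
  have [mj jm] : (m < j * L /\ j * L <= m + L)%N.
    by have := ltn_ceil m (isT : 0 < L)%N; have := leq_divM m L; rewrite /j; lia.
  (* The predecessor appears because [c 0] is [x 1]: the point [x i] is met at time
     [j * L + i.-1]. *)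
  exists (iter (j * L).-1 f y) => i /andP[i0 ilen].
  have := By (j * L + i.-1)%N; rewrite /= modnMDl modn_small; last by rewrite /L; lia.
  rewrite /c splicel; last by lia.
  rewrite prednK// -iterD; have -> : (i + (j * L).-1 = j * L + i.-1)%N by lia.
  by apply; apply: Bm; rewrite /L in mj jm *; lia.
have /choice[y yP] := fin.
(* For each fixed [i], some [y n] with [i <= n] is so near [p] that their [i]-th iterates are
   close. *)
have [p clp] := compact_seq_cluster cptX y.
exists p => i i0.
have [V entV fV] :=
  compact_unif_continuous cptX (@continuous_iter _ f i cf) entE0.
have [n ilen Vn] := clp _ entV i.
by apply: E0E; exists (iter i f (y n)); [exact: fV | apply: yP; rewrite i0].
Qed.

Lemma topological_shadowing_thick : dynamical_system f ->
  chain_recurrent_set f = [set: X] -> topological_shadowing f ->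
  topological_family_shadowing f thick thick.
Proof.
move=> [cptX cf ontof] hCR sh E entE.
have [D entD shD] := sh _ entE.
have [D' [entD' D'D ret]] := chainn_return cptX cf hCR entD.
exists D' => // x [A tA Dx].
have onto n a : exists b, iter n f b = a.
  elim: n a => [|n IHn] a; first by exists a.
  have : range f a by rewrite ontof.
  by move=> [a' _ <-]; have [b <-] := IHn a'; exists b.
have /choice[m mP] k : exists m, (k <= m)%N /\ forall i, (m <= i < m + k)%N -> A i.
  by have [m km Am] := thick_late tA k; exists m.
have /choice[u uP] k := onto (m k) (x (m k)).
have [z clz] := compact_seq_cluster cptX u.
pose Q n (g : nat -> X) := exists2 l, (0 < l)%N &
  forall i, (l <= i < l + n)%N -> g i = x i.
have [] := @glue_segments D z Q.
  move=> n w.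
  (* The jump leaves the orbit of [z] after time [w], so closeness is needed at time [w.+1]. *)
  have [V entV fV] :=
    compact_unif_continuous cptX (@continuous_iter _ f w.+1 cf) entD'.
  (* The bound puts [M] after [w] and makes the good block longer than [n]. *)
  have [k kge Vk] := clz _ entV (w.+1 + n.+1)%N.
  have [km Ak] := mP k; set M := m k in km Ak.
  pose b i := if (i <= w)%N then iter i f z else
              if (i <= M)%N then iter i f (u k) else x i.
  have bx i : (M <= i)%N -> b i = x i.
    move=> Mi; rewrite /b leqNgt (leq_trans _ Mi)/=; last by lia.
    by case: leqP => // iM; rewrite (_ : i = M) ?uP//; lia.
  have bu i : (w < i <= M)%N -> b i = iter i f (u k).
    by rewrite /b => /andP[wi ->]; rewrite leqNgt wi.
  have bz i : (i <= w)%N -> b i = iter i f z by rewrite /b => ->.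
  have Db : finite_orbit f D' (M + n) b.
    move=> i iMn; have [iw|wi] := ltnP i w.
      by rewrite !bz//; [exact: entourage_refl | exact: ltnW].
    have [iM|Mi] := ltnP i M; last first.
      by rewrite !bx//; [apply: Dx; apply: Ak; lia | exact: leqW].
    rewrite (bu i.+1) ?ltnS ?wi//.
    have [->|neiw] := eqVneq i w; first by rewrite bz//; exact: fV.
    by rewrite bu; [exact: entourage_refl | rewrite ltn_neqAle eq_sym neiw wi ltnW].
  have [||r r0 [d [d0 dr Dd]]] := ret (M + n)%N z (b (M + n)%N); first by lia.
    by exists b; split.
  exists (M + n + r)%N, (splice (M + n) b d); split.
  - by lia.
  - by apply: finite_orbit_splice => // i /Db /D'D.
  - by rewrite splicel ?bz//; lia.
  - by rewrite splicer.
  - move=> g gE; exists M => [|i iM]; first by lia.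
    by rewrite gE ?splicel ?bx//; lia.
move=> g [Dg Qg]; have [y yP] := shD g (fun i _ => Dg i).
exists y, [set i | (0 < i)%N /\ E (iter i f y, x i)] => [|i []//].
split=> [i []//|n]; have [l l0 gE] := Qg n; exists l => // i li.
have i0 : (0 < i)%N by lia.
by split=> //; rewrite -gE//; exact: yP.
Qed.

End shadowing.

(** * Density one and thickness *)

Lemma card_ord_pred_sum (P : pred nat) n :
  #|[pred i : 'I_n | P i]| = (\sum_(0 <= i < n) P i)%N.
Proof. by rewrite big_mkord -sum1_card big_mkcond. Qed.

Lemma sum_pred_le (P : pred nat) m k : (\sum_(m <= i < m + k) P i <= k)%N.
Proof.
rewrite -[leqRHS](addKn m) -[leqRHS]muln1 -sum_nat_const_nat.
by apply: leq_sum => i _; case: (P i).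
Qed.

Lemma sum_pred_lt (P : pred nat) m k j : (m <= j < m + k)%N -> ~~ P j ->
  (\sum_(m <= i < m + k) P i < k)%N.
Proof.
move=> /andP[mj jmk] nPj; rewrite (@big_cat_nat _ _ _ j)//=; last exact: ltnW.
rewrite [X in (_ + X)%N]big_ltn// (negbTE nPj) add0n.
have := sum_pred_le P m (j - m); have := sum_pred_le P j.+1 (m + k - j.+1).
by rewrite !subnKC//; lia.
Qed.

(* If A misses a point of every block of length k then it misses at least q of
   the first k q + 1 integers, so the density is at most 1 - 1/k. *)
Lemma density_one_thick (R : realType) : density_one R `<=` thick.
Proof.
move=> A [Apos dA]; split=> // k; apply: contrapT => nA.
have k0 : (0 < k)%N.
  by rewrite lt0n; apply/eqP => k0; apply: nA; exists 1%N => // i; lia.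
have miss m : (0 < m)%N -> (\sum_(m <= i < m + k) (i \in A) < k)%N.
  move=> m0; have [j mj nAj] : exists2 j, (m <= j < m + k)%N & j \notin A.
    apply: contrapT => nj; apply: nA; exists m => // i mi.
    by apply/set_mem; apply: contrapT => /negP nAi; apply: nj; exists i.
  exact: (@sum_pred_lt (fun i => i \in A) m k j).
have few q : (\sum_(0 <= i < 1 + q * k) (i \in A) + q <= 1 + q * k)%N.
  elim: q => [|q IHq].
    by rewrite mul0n !addn0; exact: (@sum_pred_le (fun i => i \in A) 0 1).
  have -> : (1 + q.+1 * k = 1 + q * k + k)%N by rewrite mulSn; lia.
  rewrite (@big_cat_nat _ _ _ (1 + q * k))//=; last exact: leq_addr.
  have := miss (1 + q * k)%N isT; lia.
(* The blocks start at 1, so index 0 is extra; the factor 2 absorbs it, since [q] misses among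
   [1 + q * k] indices are a proportion of at least [1 / (2k)] once [q] is positive. *)
have lt1 : 1 - (k.*2)%:R^-1 < 1 :> R.
  by rewrite gtrBl invr_gt0 ltr0n double_gt0.
have [N _ dN] := cvgr_gt _ dA _ lt1.
pose q := N.+1; have /dN : (N <= 1 + q * k)%N by rewrite /q; nia.
apply/negP; rewrite -leNgt card_ord_pred_sum ler_pdivrMr ?ltr0n//.
rewrite mulrBl mul1r lerBrDr.
apply: (@le_trans _ _ ((\sum_(0 <= i < 1 + q * k) (i \in A))%N%:R + q%:R)).
  rewrite lerD2l mulrC ler_pdivrMr ?ltr0n ?double_gt0// -natrM ler_nat.
  by rewrite -muln2 /q; nia.
by rewrite -natrD ler_nat.
Qed.

(** Only 0 is missed, so the ratio at [n.+1] is 1 minus a harmonic term. *)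
Lemma density_one_posn (R : realType) : density_one R posn.
Proof.
split=> //; rewrite -(cvg_shiftS (_ : nat -> R)).
have -> : (fun n => #|[pred i : 'I_n.+1 | (i : nat) \in posn]|%:R / n.+1%:R) =
    (fun n => 1 - (@harmonic R) n).
  apply/funext => n; rewrite (card_ord_pred_sum (fun i => i \in posn)) big_nat_recl//.
  have -> : (0%N \in posn) = false by apply/memNset.
  rewrite add0n.
  under eq_bigr do rewrite mem_set//.
  rewrite sum_nat_const_nat muln1 subn0 /harmonic /=.
  by rewrite -[n%:R](addrK 1) natr1 mulrBl divff ?pnatr_eq0// mul1r.
by have := cvgB (cvg_cst (1 : R)) (@cvg_harmonic R); rewrite subr0; exact.
Qed.

(** * Monotonicity in the first family and the cycle of implications *)

Lemma topological_family_shadowingW (X : uniformType) (f : X -> X)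
    (F F' G : set (set nat)) : F' `<=` F ->
  topological_family_shadowing f F G -> topological_family_shadowing f F' G.
Proof.
move=> F'F sh E /sh[D entD shD]; exists D => // x [A F'A DA].
by apply: shD; exists A => //; exact: F'F.
Qed.

Theorem theorem3p3 (R : realType) (X : uniformType) (f : X -> X)
    (hf : dynamical_system f) (hCR : chain_recurrent_set f = [set: X]) :
  [<-> topological_shadowing f;
       topological_family_shadowing f (density_one R) thick;
       topological_family_shadowing f thick thick;
       topological_family_shadowing f [set posn] thick].
Proof.
have thick_posn : thick posn.
  by apply: density_one_thick; exact: (density_one_posn R).
have sh13 := topological_shadowing_thick hf hCR.
have sh41 sh4 := thick_topological_shadowing hf sh4 hCR.
tfae.
- by move=> /sh13; apply: topological_family_shadowingW; exact: density_one_thick.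
(* The route from (2) to (3) runs through (4) and (1), as [posn] itself has density one. *)
- move=> sh2; apply/sh13/sh41; apply: topological_family_shadowingW sh2.
  by move=> _ ->; exact: density_one_posn.
- by apply: topological_family_shadowingW => _ ->.
- exact: sh41.
Qed.
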